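(* Let $M\subset K$ be number fields, and let $\mathcal{O}$ be either the ring of integers $\mathbb{Z}_K$ of $K$ or an order in $\mathbb{Z}_K$, such that $\mathcal{O}$ has a relative integral basis over $M$. If $\alpha$ generates a power integral basis of $\mathcal{O}$, then $$\alpha=A+\varepsilon\cdot\alpha_0,$$ where $\alpha_0$ is a generator of a relative power integral basis of $\mathcal{O}$ over $M$, $\varepsilon$ is a unit in $M$ (i.e. a unit of $\mathbb{Z}_M$) and $A\in\mathbb{Z}_M$.
   Context: $\mathbb{Z}_K$ and $\mathbb{Z}_M$ denote the rings of integers of $K$ and $M$. A relative integral basis of $\mathcal{O}$ over $M$ is a basis of $\mathcal{O}$ as a free $\mathbb{Z}_M$-module (so in particular $\mathbb{Z}_M\subseteq\mathcal{O}$). An element $\alpha\in\mathcal{O}$ generates a power integral basis of $\mathcal{O}$ if $\mathcal{O}=\mathbb{Z}[\alpha]$; an element $\alpha_0\in\mathcal{O}$ generates a relative power integral basis of $\mathcal{O}$ over $M$ if $\mathcal{O}=\mathbb{Z}_M[\alpha_0]$. *)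

(* Defs.v *)
From HB Require Import structures.
From mathcomp Require Import all_boot all_order all_algebra all_field.
From mathcomp Require Import boolp classical_sets.

Set Implicit Arguments.
Unset Strict Implicit.
Unset Printing Implicit Defensive.

Import GRing.Theory.
Local Open Scope classical_set_scope.
Local Open Scope ring_scope.

Section PowerIntegralBases.

(* A number field is a finite extension K of Q; its subfields are the terms of
   {subfield K}, in particular {:K} is K itself. *)
Variable K : fieldExtType rat.

Definition ring_of_integers (M : {subfield K}) : set K :=
  [set x | x \in M /\ integralOver (intr : int -> K) x].

Definition rational_integers : set K := range (intr : int -> K).

(* The first clause also says that O is stable under multiplication by S, as
   soon as S is a ring; if moreover 1 \in O, it gives S `<=` O. *)
Definition module_basis (S O : set K) (n : nat) (b : 'I_n -> K) : Prop :=
  O = [set \sum_(i < n) c i * b i | c in [set c : 'I_n -> K | forall i, S (c i)]]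
  /\ forall c : 'I_n -> K, (forall i, S (c i)) ->
       \sum_(i < n) c i * b i = 0 -> forall i, c i = 0.

Definition is_order (O : set K) : Prop :=
  [/\ subring_closed (mem O),
      O `<=` ring_of_integers {:K}%AS
    & exists b : 'I_(\dim {:K}) -> K, module_basis rational_integers O b].

Definition has_relative_integral_basis (M : {subfield K}) (O : set K) : Prop :=
  exists (n : nat) (b : 'I_n -> K), module_basis (ring_of_integers M) O b.

(* S[a], for S a subring of K. *)
Definition ring_adjoin (S : set K) (a : K) : set K :=
  [set p.[a] | p in [set p : {poly K} | p \is a polyOver (mem S)]].

Definition generates_power_integral_basis (O : set K) (a : K) : Prop :=
  O a /\ O = ring_adjoin rational_integers a.

Definition generates_relative_power_integral_basis
    (M : {subfield K}) (O : set K) (a : K) : Prop :=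
  O a /\ O = ring_adjoin (ring_of_integers M) a.

Definition integral_unit (M : {subfield K}) (e : K) : Prop :=
  ring_of_integers M e /\ exists2 d, ring_of_integers M d & e * d = 1.

End PowerIntegralBases.

(* Main.v *)
Require Import Defs.
From HB Require Import structures.
From mathcomp Require Import all_boot all_order all_algebra all_field.
From mathcomp Require Import boolp classical_sets.

Import GRing.Theory.
Local Open Scope classical_set_scope.
Local Open Scope ring_scope.

(** The generator [alpha] is itself a relative generator, so the decomposition
    [alpha = 0 + 1 * alpha] has the required form.  Indeed, write Z_M for the
    ring of integers of [M].  A relative integral basis makes [O] stable under
    multiplication by Z_M, and [1 \in O], so Z_M is contained in [O]
    ([coefficients_sub_module]); as [O] is a ring containing [alpha], it follows
    that Z_M[alpha] is contained in [O] ([ring_adjoin_min]).  Conversely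
    [O], being Z[alpha], is contained in Z_M[alpha] because rational integers lie in
    Z_M ([ring_adjoin_mono]). *)

Lemma ring_of_integers_subring (K : fieldExtType rat) (M : {subfield K}) :
  subring_closed (mem (ring_of_integers M)).
Proof.
split=> [|x y|x y].
- by apply/mem_set; split; [exact: mem1v | exact: integral1].
- move=> /set_mem[Mx Zx] /set_mem[My Zy].
  by apply/mem_set; split; [exact: rpredB | exact: integral_sub].
- move=> /set_mem[Mx Zx] /set_mem[My Zy].
  by apply/mem_set; split; [exact: rpredM | exact: integral_mul].
Qed.

Lemma rational_integers_sub (K : fieldExtType rat) (M : {subfield K}) :
  @rational_integers K `<=` ring_of_integers M.
Proof.
move=> _ [n _ <-]; split; first exact: rpred_int.
exact: integral_id.
Qed.

Lemma ring_adjoin_mono (K : fieldExtType rat) (S T : set K) (a : K) :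
  S `<=` T -> ring_adjoin S a `<=` ring_adjoin T a.
Proof.
move=> sST _ [p Sp <-]; exists p => //.
by apply: polyOverS Sp => c /set_mem Sc; exact/mem_set/sST.
Qed.

Lemma ring_adjoin_min (K : fieldExtType rat) (S O : set K) (a : K) :
  subring_closed (mem O) -> S `<=` O -> O a -> ring_adjoin S a `<=` O.
Proof.
move=> ringO sSO Oa _ [p Sp <-].
(* Bundling the closure proof lets evaluation of polynomials stay in [O]. *)
pose O' : subringClosed K :=
  HB.pack (mem O : {pred K}) (GRing.isSubringClosed.Build K (mem O) ringO).
apply/set_mem; change (p.[a] \in O').
apply: rpred_horner; last exact: mem_set.
by apply: polyOverS Sp => c /set_mem Sc; exact/mem_set/sSO.
Qed.

(** For [c] in [S], multiplying by [c] the coordinates of [1 \in O] gives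
    coordinates of [c]. *)
Lemma coefficients_sub_module (K : fieldExtType rat) (S O : set K) (n : nat)
    (b : 'I_n -> K) :
  subring_closed (mem S) -> module_basis S O b -> O 1 -> S `<=` O.
Proof.
move=> [_ _ mulS] [-> _] [u Su u1] c Sc.
exists (fun i => c * u i) => [i|].
  by apply/set_mem/mulS; apply/mem_set.
by under eq_bigr do rewrite -mulrA; rewrite -mulr_sumr u1 mulr1.
Qed.

Theorem proposition3 (K : fieldExtType rat) (M : {subfield K}) (O : set K)
    (hO : O = ring_of_integers {:K}%AS \/ is_order O)
    (hrel : has_relative_integral_basis M O)
    (alpha : K) (halpha : generates_power_integral_basis O alpha) :
  exists A eps alpha0 : K,
    [/\ alpha = A + eps * alpha0,
        generates_relative_power_integral_basis M O alpha0,
        integral_unit M eps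
      & ring_of_integers M A].
Proof.
have ringO : subring_closed (mem O).
  by case: hO => [->|[]//]; exact: ring_of_integers_subring.
have ringM := ring_of_integers_subring K M.
have [Oalpha eqO] := halpha.
have O1 : O 1 by case: ringO => /set_mem.
have M1 : ring_of_integers M 1 by case: ringM => /set_mem.
have sMO : ring_of_integers M `<=` O.
  by case: hrel => n [b basisO]; exact: coefficients_sub_module basisO O1.
exists 0, 1, alpha; split; first by rewrite mul1r add0r.
- split=> //; apply/seteqP; split; last exact: ring_adjoin_min.
  by rewrite {1}eqO; apply/ring_adjoin_mono/rational_integers_sub.
- by split=> //; exists 1; rewrite ?mul1r.
- by split; [exact: mem0v | exact: integral0].
Qed.
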